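(* Let $F$ be a given function of order $O(R^{-3})$ and let $\phi$ be a solution of the ugly equation with $p=1$ in Minkowski spacetime, $$\square\phi=\frac{2}{R}\,\nabla_T\phi+F ,$$ satisfying $\phi=o^+(1)$ near null infinity. Then $$\square\big(R\,\nabla_{\underline\psi}\phi\big)=\frac{1}{R}\,\nabla_{\underline\psi}\big(R^2F\big).$$ If the derivative of $F$ along $\underline\psi$ does not improve its decay, this is a bad equation for $R\,\nabla_{\underline\psi}\phi$; it becomes a good equation if $F=0$ or if the derivative of $F$ along $\underline\psi$ improves its decay.
   Context: Minkowski spacetime has inertial Cartesian coordinates $(T,X^1,X^2,X^3)$, radius $R=|X|$, and associated shell (spherical polar) coordinates $(T,R,\theta^A)$. $\square$ is the standard wave operator of the flat metric with signature $(-,+,+,+)$, that is $\square=-\partial_T^2+\sum_{i}\partial_{X^i}^2$. The outgoing and incoming null vector fields, in the shell coordinate basis, are $\psi=\partial_T+\partial_R$ and $\underline\psi=\partial_T-\partial_R$; for a scalar function $f$, $\nabla_Tf=\partial_Tf$ and $\nabla_{\underline\psi}f=\partial_Tf-\partial_Rf$. The notation $f=o^+(h)$ means that there exists $\epsilon>0$ with $\lim_{R\to\infty}\frac{f}{hR^{-\epsilon}}=0$. The good-bad-ugly model consists of the equations $\square g=F_g$ (good), $\square b=(\nabla_Tg)^2+F_b$ (bad), and $\square u=\frac{2p}{R}\nabla_Tu+F_u$ (ugly, with $p$ a natural number), where $F_g,F_b,F_u$ are given functions of order $O(R^{-3})$. Thus a good equation is a wave equation with source of order $O(R^{-3})$,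 while the source of a bad equation is in general only $O(R^{-2})$. It is a standing assumption of the model that derivatives of the evolved fields along $\underline\psi$ or $\partial_T$ (bad derivatives) keep their decay near null infinity, whereas derivatives along $\psi$ (good derivatives) improve it. *)

(* Defs.v *)
From HB Require Import structures.
From mathcomp Require Import all_boot all_order all_algebra.
From mathcomp Require Import all_classical all_reals all_analysis.

Set Implicit Arguments.
Unset Strict Implicit.
Unset Printing Implicit Defensive.

Import Order.TTheory GRing.Theory Num.Theory.
Import numFieldNormedType.Exports.

Local Open Scope classical_set_scope.
Local Open Scope ring_scope.

(* A spacetime point is a row vector of inertial coordinates (T, X^1, X^2, X^3):
   T is the entry of index [ord0], X^(i+1) the entry of index [lift ord0 i]. *)
Definition time (R : realType) (x : 'rV[R]_4) : R := x 0 ord0.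

Definition spatial (R : realType) (x : 'rV[R]_4) (i : 'I_3) : R :=
  x 0 (lift ord0 i).

(* The Euclidean norm |X|; the library norm on ['rV_4] is the sup norm. *)
Definition shell_radius (R : realType) (x : 'rV[R]_4) : R :=
  Num.sqrt (\sum_(i < 3) spatial x i ^+ 2).

(* The domain of the shell coordinates, as far as T and R are concerned:
   Minkowski spacetime without the worldline R = 0. *)
Definition off_axis (R : realType) : set 'rV[R]_4 :=
  [set x | 0 < shell_radius x].
Arguments off_axis : clear implicits.

Definition partial (R : realType) (i : 'I_4) (f : 'rV[R]_4 -> R)
    (x : 'rV[R]_4) : R :=
  'D_(delta_mx 0 i) f x.

Definition box (R : realType) (f : 'rV[R]_4 -> R) (x : 'rV[R]_4) : R :=
  - partial ord0 (partial ord0 f) x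
  + \sum_(i < 3) partial (lift ord0 i) (partial (lift ord0 i) f) x.

(* The vector (0, X / R).  The shell coordinate vector d/dR is taken at fixed T
   and fixed angles, so it is the derivative in this direction. *)
Definition radial (R : realType) (x : 'rV[R]_4) : 'rV[R]_4 :=
  \row_j (if j == ord0 then 0 else x 0 j / shell_radius x).

Definition dT (R : realType) (f : 'rV[R]_4 -> R) (x : 'rV[R]_4) : R :=
  partial ord0 f x.

Definition dR (R : realType) (f : 'rV[R]_4 -> R) (x : 'rV[R]_4) : R :=
  'D_(radial x) f x.

(* The derivative along the incoming null vector d/dT - d/dR. *)
Definition dpsibar (R : realType) (f : 'rV[R]_4 -> R) (x : 'rV[R]_4) : R :=
  dT f x - dR f x.

(* f is of class C^k on U, for U open. *)
Fixpoint Ck (R : realType) (k : nat) (U : set 'rV[R]_4) (f : 'rV[R]_4 -> R)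
    : Prop :=
  match k with
  | 0 => forall x, U x -> {for x, continuous f}
  | k'.+1 => (forall x, U x -> differentiable f x) /\
             (forall i, Ck k' U (partial i f))
  end.

(* The limit R -> +oo towards null infinity, taken along the outgoing null
   cones T - R = const with T - R in [a, b], uniformly in T - R and in the
   angles. *)
Definition null_infinity (R : realType) (a b : R) : set_system 'rV[R]_4 :=
  [set A | \forall r \near +oo,
    forall x, shell_radius x = r -> a <= time x - shell_radius x <= b -> A x].

Global Instance null_infinity_filter (R : realType) (a b : R) :
  Filter (null_infinity a b).
Proof.
split.
- by apply: nearW => r x _ _.
- move=> P Q; rewrite /null_infinity /=; apply: filterS2 => r hP hQ x xr xab.
  by split; [exact: hP|exact: hQ].
- move=> P Q PQ; rewrite /null_infinity /=; apply: filterS => r hP x xr xab.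
  exact/PQ/hP.
Qed.

Canonical null_infinity_filter_on (R : realType) (a b : R) :=
  FilterType (null_infinity a b) (null_infinity_filter a b).

(* f = O(R^-n) near null infinity; the constant may depend on the retarded time
   window. *)
Definition decays (R : realType) (n : nat) (f : 'rV[R]_4 -> R) : Prop :=
  forall a b : R, f =O_ (null_infinity a b) (fun x => (shell_radius x) ^- n).

(* f = o^+(h) near null infinity. *)
Definition oplus (R : realType) (f h : 'rV[R]_4 -> R) : Prop :=
  exists2 e : R, 0 < e &
    forall a b : R,
      (fun x => f x / (h x * shell_radius x `^ (- e))) @ null_infinity a b --> 0.

Definition wave_equation (R : realType) (f S : 'rV[R]_4 -> R) : Prop :=
  forall x, off_axis R x -> box f x = S x.

Definition ugly_equation (R : realType) (p : nat) (u F : 'rV[R]_4 -> R)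
    : Prop :=
  wave_equation u (fun x => (2 * p)%:R / shell_radius x * dT u x + F x).

(* The types "good" and "bad" of a wave equation with a given source refer to
   the order of that source: O(R^-3) for a good equation; O(R^-2), but not
   O(R^-3), for a bad one.  The source (d_T g)^2 + F_b of the model bad equation
   is an instance of the latter for g decaying generically, like R^-1. *)
Definition good_equation (R : realType) (g S : 'rV[R]_4 -> R) : Prop :=
  wave_equation g S /\ decays 3 S.

Definition bad_equation (R : realType) (b S : 'rV[R]_4 -> R) : Prop :=
  [/\ wave_equation b S, decays 2 S & ~ decays 3 S].

(* Main.v *)
(* Multiplying d_T - d_R by R gives the vector field R d_T - X^i d_i, so that
   R psibar(phi) = R a - X^i b_i for a = d_T phi and b_i = d_i phi.  The product
   rule yields
     box (R a - X^i b_i) =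
       R box a - X^i box b_i + (2/R) X^i d_i a + (2/R) a - 2 d_i b_i.
   By the symmetry of third derivatives, box a and box b_i are derivatives of
   box phi = (2/R) a + F, and everything cancels but R psibar(F) - 2 F, which
   is psibar(R^2 F) / R.  As F = O(R^-3), this source is O(R^-n), for n = 2, 3,
   as soon as psibar(F) is O(R^-(n+1)), and conversely for n = 3. *)
Require Import Defs.
From HB Require Import structures.
From mathcomp Require Import all_boot all_order all_algebra.
From mathcomp Require Import ring.
From mathcomp Require Import all_classical all_reals all_analysis.

Set Implicit Arguments.
Unset Strict Implicit.
Unset Printing Implicit Defensive.

Import Order.TTheory GRing.Theory Num.Theory.
Import numFieldNormedType.Exports.

Local Open Scope classical_set_scope.
Local Open Scope ring_scope.

(** * Symmetry of second directional derivatives *)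

Section MixedDerivatives.
Variables (R : realType) (V : normedModType R).
Implicit Types (f : V -> R) (x u v : V).

(** Both difference quotients are the same function of the increment. This brings directional
    derivatives within reach of the one-variable mean value theorem. *)
Lemma is_derive_line f x u (t : R) : derivable f (x + t *: u) u ->
  is_derive t 1 (fun s => f (x + s *: u)) ('D_u f (x + t *: u)).
Proof.
have E : (fun h : R => h^-1 *: (((fun s => f (x + s *: u)) \o shift t) (h *: 1)
             - f (x + t *: u)))
    = (fun h => h^-1 *: ((f \o shift (x + t *: u)) (h *: u) - f (x + t *: u))).
  apply/funext => h /=; rewrite -[h *: 1]/(h * 1) mulr1 scalerDl.
  by rewrite addrCA.
by move=> df; split; rewrite /derivable /derive E.
Qed.

Lemma is_derive_translate f x u c df :
  is_derive (x + c) u f df -> is_derive x u (fun y => f (y + c)) df.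
Proof.
have E : (fun k : R => k^-1 *: (((fun y => f (y + c)) \o shift x) (k *: u)
      - f (x + c))) =
    (fun k => k^-1 *: ((f \o shift (x + c)) (k *: u) - f (x + c))).
  by apply/funext => k /=; rewrite addrA.
by case=> fd <-; apply: DeriveDef; rewrite /derivable /derive E.
Qed.

Lemma MVT_line f x u (h : R) : 0 < h ->
    (forall t, 0 <= t <= h -> derivable f (x + t *: u) u) ->
  exists2 t, 0 <= t <= h & f (x + h *: u) - f x = h * 'D_u f (x + t *: u).
Proof.
move=> h0 df.
have df' t : t \in `[0, h] -> is_derive t 1 (fun s => f (x + s *: u))
    ('D_u f (x + t *: u)).
  by rewrite in_itv => /df/is_derive_line.
have [t tI] := MVT_segment (ltW h0) (fun t tI => df' t (subset_itv_oo_cc tI))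
  (derivable_within_continuous (fun t tI => ex_derive (is_derive := df' t tI))).
rewrite scale0r addr0 subr0 => E.
by exists t; [move: tI; rewrite in_itv | rewrite mulrC].
Qed.

(** The mean value theorem is applied along [u] to the increment [f (y + h *: v) - f y], then along
    [v] to the resulting difference of values of ['D_u f]. *)
Lemma second_difference f x u v (h : R) : 0 < h ->
    (forall s t, 0 <= s <= h -> 0 <= t <= h ->
       derivable f (x + s *: u + t *: v) u /\
       derivable ('D_u f) (x + s *: u + t *: v) v) ->
  exists s t, [/\ 0 <= s <= h, 0 <= t <= h &
    f (x + h *: u + h *: v) - f (x + h *: u) - (f (x + h *: v) - f x) =
    h * (h * 'D_v ('D_u f) (x + s *: u + t *: v))].
Proof.
move=> h0 df; have h0h : 0 <= h <= h by rewrite lexx ltW.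
have h00 : 0 <= (0 : R) <= h by rewrite lexx ltW.
pose g y := f (y + h *: v) - f y.
have dg s : 0 <= s <= h -> is_derive (x + s *: u) u g
    ('D_u f (x + s *: u + h *: v) - 'D_u f (x + s *: u)).
  move=> sh; have [d1 _] := df s h sh h0h; have [d2 _] := df s 0 sh h00.
  rewrite scale0r addr0 in d2.
  apply: is_deriveB; last exact: derivableP.
  exact: (is_derive_translate (derivableP d1)).
have [s sh E] := MVT_line h0 (fun s sh => ex_derive (is_derive := dg s sh)).
have [t th E'] := MVT_line h0 (fun t th => (df s t sh th).2).
exists s, t; split=> //.
rewrite -E' -(derive_val (is_derive := dg s sh)) -E /g.
by ring.
Qed.

(* Both mixed derivatives are read off one second difference over a small
   parallelogram, by applying the mean value theorem in either order. *)
Lemma derive_comm f x u v :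
    (\forall y \near x, [/\ derivable f y u, derivable f y v,
       derivable ('D_u f) y v & derivable ('D_v f) y u]) ->
    {for x, continuous ('D_v ('D_u f))} ->
    {for x, continuous ('D_u ('D_v f))} ->
  'D_v ('D_u f) x = 'D_u ('D_v f) x.
Proof.
move=> df cA cB.
(* Regrouping the four corner values exchanges the roles of [u] and [v]. *)
have swap (a b c d : R) : a - b - (c - d) = a - c - (b - d) by ring.
apply/eqP; rewrite -subr_eq0 -normr_le0.
apply/ler_addgt0Pr => _ /posnumP[e]; rewrite add0r.
have e2 : 0 < e%:num / 2 by [].
have half (a b c : R) : `|a - c| < e%:num / 2 -> `|b - c| < e%:num / 2 ->
    `|a - b| <= e%:num.
  move=> ac bc; rewrite (le_trans (ler_distD c _ _))// [e%:num]splitr.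
  by rewrite lerD// ltW// distrC.
have nA := @cvgr_dist_lt _ _ _ _ _ _ _ cA _ e2.
have nB := @cvgr_dist_lt _ _ _ _ _ _ _ cB _ e2.
have [r /= r0 near_x] := (nbhs_normP _ _).1
  (filterI (filterI df (nA _)) (nB _)).
(* This choice makes [h] times the sum of the two norms smaller than [r], so the parallelogram stays
   in the ball; the [1] covers [u = v = 0]. *)
pose h := r / (`|u| + `|v| + 1).
have n0 : 0 < `|u| + `|v| + 1 by rewrite ltr_wpDl ?addr_ge0.
have h0 : 0 < h by rewrite divr_gt0.
have inball (s t : R) : 0 <= s <= h -> 0 <= t <= h -> 
    ball_ Num.norm x r (x + s *: u + t *: v).
  move=> /andP[s0 sh] /andP[t0 th]; rewrite /= -addrA opprD addNKr.
  rewrite normrN (le_lt_trans (ler_normD _ _))// !normrZ !ger0_norm//.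
  have -> : r = h * (`|u| + `|v| + 1) by rewrite divfK ?gt_eqF.
  rewrite mulrDr mulr1 (@le_lt_trans _ _ (h * (`|u| + `|v|)))//; last first.
    by rewrite ltrDl.
  by rewrite mulrDr lerD// ler_wpM2r.
have near_st (s t : R) : 0 <= s <= h -> 0 <= t <= h -> _ :=
  fun sh th => near_x _ (inball s t sh th).
have [s [t [sh th E]]] := @second_difference f x u v h h0
  (fun s t sh th =>
    let: conj (conj (And4 d1 _ d2 _) _) _ := near_st s t sh th in conj d1 d2).
have near_ts (p q : R) : 0 <= p <= h -> 0 <= q <= h ->
    derivable f (x + p *: v + q *: u) v /\
    derivable ('D_v f) (x + p *: v + q *: u) u.
  move=> ph qh; rewrite addrAC; have [[[_ d1 _ d2] _] _] := near_st q p qh ph.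
  exact: conj d1 d2.
have [t' [s' [th' sh' E']]] := second_difference h0 near_ts.
(* Both values are the same second difference divided twice by [h]; each lies within half of [e] of
   its limit at [x]. *)
have EE : 'D_v ('D_u f) (x + s *: u + t *: v) =
    'D_u ('D_v f) (x + s' *: u + t' *: v).
  apply: (mulfI (negbT (gt_eqF h0))); apply: (mulfI (negbT (gt_eqF h0))).
  rewrite (addrAC x (h *: v) (h *: u)) (addrAC x (t' *: v) (s' *: u)) in E'.
  exact: etrans (esym E) (etrans (swap _ _ _ _) E').
have [[_ A] _] := near_st s t sh th.
have [_ B] := near_st s' t' sh' th'.
exact: half _ _ _ A (eq_ind_r (fun a => `|_ - a| < _) B EE).
Qed.

End MixedDerivatives.

Local Opaque derive.

(** * Derivatives of the shell radius, and differentiation off the axis *)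

Section OffAxis.
Variable R : realType.
Implicit Types (f g : 'rV[R]_4 -> R) (x v : 'rV[R]_4) (i j : 'I_3) (k : 'I_4).

(** A coordinate is a continuous linear map, hence its own differential; the linear structure is
    packed by hand for [diff_lin]. *)
Lemma is_derive_spatial x v i :
  is_derive x v (fun y => spatial y i) (spatial v i).
Proof.
have L : linear (fun y : 'rV[R]_4 => spatial y i).
  by move=> c y z; rewrite /spatial !mxE.
pose l := GRing.isLinear.Build _ _ _ _ _ L.
pose f : {linear 'rV[R]_4 -> R} := HB.pack (fun y : 'rV[R]_4 => spatial y i) l.
have cf : continuous f by move=> y; exact: coord_continuous.
apply: DeriveDef; first exact/diff_derivable/(differentiable_coord x).
by rewrite deriveE ?(diff_lin _ cf)//; exact: (differentiable_coord x).
Qed.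

Lemma shell_radius_ge0 x : 0 <= shell_radius x.
Proof. exact: sqrtr_ge0. Qed.

Lemma sqr_shell_radius x : shell_radius x ^+ 2 = \sum_i spatial x i ^+ 2.
Proof. by rewrite sqr_sqrtr// sumr_ge0// => i _; exact: sqr_ge0. Qed.

Lemma off_axis_neq0 x : off_axis R x -> shell_radius x != 0.
Proof. by move/lt0r_neq0. Qed.

Lemma is_derive_sqr_shell_radius x v :
  is_derive x v (fun y => \sum_i spatial y i ^+ 2)
    (2 * \sum_i spatial x i * spatial v i).
Proof.
have E : (fun y : 'rV[R]_4 => \sum_i spatial y i ^+ 2) =
    \sum_i (fun y => spatial y i) ^+ 2.
  by apply/funext => y; rewrite fct_sumE.
rewrite E; apply: is_derive_eq.
  by apply: is_derive_sum => i; apply: is_deriveX; exact: is_derive_spatial.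
rewrite mulr_sumr; apply: eq_bigr => i _.
by rewrite /GRing.scale /= expr1 mulrA.
Qed.

Lemma differentiable_sqr_shell_radius x :
  differentiable (fun y : 'rV[R]_4 => \sum_i spatial y i ^+ 2) x.
Proof.
have -> : (fun y : 'rV[R]_4 => \sum_i spatial y i ^+ 2) =
    \sum_i (fun y => spatial y i) ^+ 2.
  by apply/funext => y; rewrite fct_sumE.
apply: differentiable_sum => i; apply: differentiableX.
exact: differentiable_coord.
Qed.

Lemma differentiable_sqrt (r : R) : 0 < r -> differentiable Num.sqrt r.
Proof.
by move=> r0; apply/derivable1_diffP; have [] := is_derive1_sqrt r0.
Qed.

Lemma off_axis_sqr_gt0 x : off_axis R x -> 0 < \sum_i spatial x i ^+ 2.
Proof. by rewrite /off_axis /= /shell_radius sqrtr_gt0. Qed.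

Lemma differentiable_shell_radius x : off_axis R x ->
  differentiable (@shell_radius R) x.
Proof.
move=> Ux; apply: differentiable_comp (differentiable_sqr_shell_radius x) _.
exact/differentiable_sqrt/off_axis_sqr_gt0.
Qed.

Lemma is_derive_shell_radius x v : off_axis R x ->
  is_derive x v (@shell_radius R)
    ((shell_radius x)^-1 * \sum_i spatial x i * spatial v i).
Proof.
move=> Ux; have q0 := off_axis_sqr_gt0 Ux.
have dq := differentiable_sqr_shell_radius x.
have ds := differentiable_sqrt q0.
apply: DeriveDef; first exact/diff_derivable/differentiable_shell_radius.
rewrite deriveE; last exact: differentiable_shell_radius.
rewrite (diff_comp dq ds) /= -(deriveE v dq).
rewrite (derive_val (is_derive := is_derive_sqr_shell_radius x v)).
rewrite (diff1E ds) derive1E (derive_sqrt q0) -/(shell_radius x).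
have := off_axis_neq0 Ux; move: (shell_radius x) => r r0.
by rewrite /GRing.scale /=; field.
Qed.

Lemma open_off_axis : open (off_axis R).
Proof.
have cq : continuous (fun y : 'rV[R]_4 => \sum_i spatial y i ^+ 2).
  by move=> y; exact/differentiable_continuous/differentiable_sqr_shell_radius.
have cr : continuous (@shell_radius R).
  by move=> y; apply: continuous_comp; [exact: cq|exact: sqrt_continuous].
apply: (@open_comp _ _ (@shell_radius R) [set r | 0 < r]).
  by move=> y _; exact: cr.
exact: open_gt.
Qed.

Lemma near_off_axis x : off_axis R x -> \forall y \near x, off_axis R y.
Proof. by move=> Ux; exact: open_nbhs_nbhs (conj open_off_axis Ux). Qed.

(** Derivatives are local and the domain is open, so an identity known only off the axis may be
    differentiated there. *)
Lemma derive_off_axis f g x v : {in off_axis R, f =1 g} -> off_axis R x ->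
  'D_v f x = 'D_v g x.
Proof.
move=> fg Ux; apply: near_eq_derive; apply: filterS (near_off_axis Ux) => y Uy.
by apply: fg; rewrite inE.
Qed.

Lemma partial_off_axis f g k : {in off_axis R, f =1 g} ->
  {in off_axis R, partial k f =1 partial k g}.
Proof. by move=> fg x; rewrite inE; exact: derive_off_axis. Qed.

Lemma box_off_axis f g : {in off_axis R, f =1 g} ->
  {in off_axis R, box f =1 box g}.
Proof.
move=> fg x Ux.
have E k : partial k (partial k f) x = partial k (partial k g) x.
  exact: (partial_off_axis k (partial_off_axis k fg)).
rewrite /box E; apply: f_equal; apply: eq_bigr => i _; exact: E.
Qed.

Lemma dpsibar_off_axis f g : {in off_axis R, f =1 g} ->
  {in off_axis R, dpsibar f =1 dpsibar g}.
Proof.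
move=> fg x; rewrite inE => Ux.
rewrite /dpsibar /dT /dR (partial_off_axis _ fg) ?inE//.
by rewrite (derive_off_axis _ fg).
Qed.

Lemma partial_comm f k l : Ck 2 (off_axis R) f ->
  {in off_axis R, partial k (partial l f) =1 partial l (partial k f)}.
Proof.
move=> [df Cf] x; rewrite inE => Ux.
apply: derive_comm.
- apply: filterS (near_off_axis Ux) => y Uy.
  by split; apply: diff_derivable; [exact: df|exact: df|exact: (Cf _).1|
    exact: (Cf _).1].
- exact: (Cf l).2.
- exact: (Cf k).2.
Qed.

End OffAxis.

(** * The operator R d_T - X^i d_i and its interplay with the wave operator *)

Section Incoming.
Variable R : realType.
Implicit Types (f g a : 'rV[R]_4 -> R) (b : 'I_3 -> 'rV[R]_4 -> R).
Implicit Types (x v : 'rV[R]_4) (i j : 'I_3) (k : 'I_4).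

(** In this form linearity of the differential turns R d_R into X^i d_i. *)
Lemma radialE x : radial x =
  (shell_radius x)^-1 *: \sum_i spatial x i *: delta_mx 0 (lift ord0 i).
Proof.
apply/rowP => k; rewrite !mxE summxE; case: (unliftP ord0 k) => [i ->|->].
  rewrite (bigD1 i)//= big1 => [|j /negPf ji].
    by rewrite !mxE !eqxx mulr1 addr0 mulrC.
  by rewrite !mxE (inj_eq lift_inj) eq_sym ji mulr0.
by rewrite eqxx big1 ?mulr0// => i _; rewrite !mxE /= mulr0.
Qed.

Lemma sum_spatial_time (c : 'I_3 -> R) :
  \sum_i c i * spatial (delta_mx 0 ord0) i = 0.
Proof. by apply: big1 => i _; rewrite /spatial mxE mulr0. Qed.

Lemma spatial_space i j :
  spatial (delta_mx 0 (lift ord0 j) : 'rV[R]_4) i = (i == j)%:R.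
Proof. by rewrite /spatial mxE eqxx /= (inj_eq lift_inj). Qed.

Lemma sum_spatial_space (c : 'I_3 -> R) j :
  \sum_i c i * spatial (delta_mx 0 (lift ord0 j)) i = c j.
Proof.
rewrite (bigD1 j)//= big1 => [|i /negPf ij].
  by rewrite spatial_space eqxx mulr1 addr0.
by rewrite spatial_space ij mulr0.
Qed.

Lemma spatial_radial x i : spatial (radial x) i = spatial x i / shell_radius x.
Proof. by rewrite /spatial mxE. Qed.

(* R d/dT - X^i d/dX^i applied to phi, for a = d_T phi and b_i = d_i phi. *)
Definition incoming a b x := shell_radius x * a x - \sum_i spatial x i * b i x.

Lemma incoming_dpsibar f x : off_axis R x -> differentiable f x ->
  shell_radius x * dpsibar f x =
  incoming (partial ord0 f) (fun i => partial (lift ord0 i) f) x.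
Proof.
move=> Ux df; rewrite /dpsibar mulrBr; congr (_ - _).
rewrite /dR (deriveE _ df) radialE linearZ linear_sum /=.
rewrite [_ *: _]/(_ * _) mulrA mulfV ?off_axis_neq0// mul1r.
by apply: eq_bigr => i _; rewrite linearZ /= /partial (deriveE _ df).
Qed.

(** Product rule: the last two terms come from differentiating the coefficients R and X^i. *)
Lemma is_derive_incoming a b x v (da : R) (db : 'I_3 -> R) : off_axis R x ->
    is_derive x v a da -> (forall i, is_derive x v (b i) (db i)) ->
  is_derive x v (incoming a b)
    (shell_radius x * da - \sum_i spatial x i * db i
     + (shell_radius x)^-1 * (\sum_i spatial x i * spatial v i) * a x
     - \sum_i b i x * spatial v i).
Proof.
move=> Ux ha hb.
have -> : incoming a b =
    @shell_radius R * a - \sum_i ((fun y => spatial y i) * b i).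
  by apply/funext => y; rewrite /incoming /= fct_sumE.
have dr := is_derive_shell_radius v Ux.
have ds i := is_derive_spatial x v i.
apply: is_derive_eq.
rewrite /GRing.scale /= big_split /= opprD.
by ring.
Qed.

Lemma is_derive_partial f k x : differentiable f x ->
  is_derive x (delta_mx 0 k) f (partial k f x).
Proof. by move=> df; exact/derivableP/diff_derivable. Qed.

(** The coefficients R and X^i do not depend on T. *)
Lemma partial_time_incoming a b x : off_axis R x ->
    differentiable a x -> (forall i, differentiable (b i) x) ->
  partial ord0 (incoming a b) x =
  incoming (partial ord0 a) (fun i => partial ord0 (b i)) x.
Proof.
move=> Ux da db; have ha := is_derive_partial ord0 da.
have hb i := is_derive_partial ord0 (db i).
rewrite /partial (derive_val (is_derive := is_derive_incoming Ux ha hb)).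
by rewrite !sum_spatial_time mulr0 mul0r addr0 subr0.
Qed.

(** The remainder reflects d_j R = X^j / R and d_j X^i = delta_ij. *)
Lemma partial_space_incoming a b j x : off_axis R x ->
    differentiable a x -> (forall i, differentiable (b i) x) ->
  let d := partial (lift ord0 j) in
  d (incoming a b) x = incoming (d a) (fun i => d (b i)) x
    + ((shell_radius x)^-1 * spatial x j * a x - b j x).
Proof.
move=> Ux da db d; have ha := is_derive_partial (lift ord0 j) da.
have hb i := is_derive_partial (lift ord0 j) (db i).
rewrite /d /partial (derive_val (is_derive := is_derive_incoming Ux ha hb)).
by rewrite !sum_spatial_space -addrA.
Qed.

Lemma is_derive_inv_shell_radius x v : off_axis R x ->
  is_derive x v (fun y => (shell_radius y)^-1)
    (- (shell_radius x)^-3 * \sum_i spatial x i * spatial v i).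
Proof.
move=> Ux; have r0 := off_axis_neq0 Ux.
have dr := is_derive_shell_radius v Ux.
have [dR ER] := dr.
apply: DeriveDef; first exact: derivableV.
rewrite (deriveV r0 dR) ER /GRing.scale /= mulrA; congr (_ * _).
by field.
Qed.

(** This differentiates the remainder of [partial_space_incoming] once more; the coefficient of
    [a x] is d_j (X^j / R). *)
Lemma partial_space_direction a j x : off_axis R x -> differentiable a x ->
  let d := partial (lift ord0 j) in
  d (fun y => (shell_radius y)^-1 * spatial y j * a y) x =
  (shell_radius x)^-1 * spatial x j * d a x +
  ((shell_radius x)^-1 - (shell_radius x)^-3 * spatial x j ^+ 2) * a x.
Proof.
move=> Ux da d.
have ha := is_derive_partial (lift ord0 j) da.
have hr := is_derive_inv_shell_radius (delta_mx 0 (lift ord0 j)) Ux.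
have hs := is_derive_spatial x (delta_mx 0 (lift ord0 j)) j.
rewrite /d /partial.
rewrite (derive_val (is_derive := is_deriveM (is_deriveM hr hs) ha)).
rewrite sum_spatial_space.
rewrite -/(partial _ a x) spatial_space eqxx.
rewrite -[(_ * _) x]/((shell_radius x)^-1 * spatial x j) /GRing.scale /=.
by ring.
Qed.

(** The derivatives at a point become independent unknowns: [a00] and [a11 j] are the pure second
    derivatives of a, [b00 i] and [b11 j i] those of b_i, and [bd j] is d_j b_j. *)
Lemma box_incoming_algebra (r a a00 : R) (X a1 a11 b00 bd : 'I_3 -> R)
    (b11 : 'I_3 -> 'I_3 -> R) : r != 0 -> r ^+ 2 = \sum_i X i ^+ 2 ->
  - (r * a00 - \sum_i X i * b00 i) +
    \sum_j (r * a11 j - \sum_i X i * b11 j i + (r^-1 * X j * a1 j - bd j)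
      + (r^-1 * X j * a1 j + (r^-1 - r^-3 * X j ^+ 2) * a - bd j)) =
  r * (- a00 + \sum_j a11 j) - \sum_i X i * (- b00 i + \sum_j b11 j i)
    + 2 / r * (\sum_i X i * a1 i) + 2 / r * a - 2 * (\sum_i bd i).
Proof.
move=> r0 rX.
(* The divergence of the unit radial field in three dimensions: 3 / R - R^2 / R^3. *)
have e : \sum_j (r^-1 - r^-3 * X j ^+ 2) = 2 / r.
  rewrite sumrB -mulr_sumr -rX big_const_ord iter_addr_0.
  by field.
rewrite -[X in _ + X * a - _]e !big_ord_recl !big_ord0; ring.
Qed.

Lemma box_incoming a b x : off_axis R x -> Ck 2 (off_axis R) a ->
    (forall i, Ck 2 (off_axis R) (b i)) ->
  box (incoming a b) x = incoming (box a) (fun i => box (b i)) x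
    + 2 / shell_radius x * (\sum_i spatial x i * partial (lift ord0 i) a x)
    + 2 / shell_radius x * a x
    - 2 * (\sum_i partial (lift ord0 i) (b i) x).
Proof.
move=> Ux [da Ca] Cb.
have db i y : off_axis R y -> differentiable (b i) y := (Cb i).1 y.
have dda k y : off_axis R y -> differentiable (partial k a) y := (Ca k).1 y.
have ddb i k y : off_axis R y -> differentiable (partial k (b i)) y :=
  ((Cb i).2 k).1 y.
rewrite {1}/box.
have -> : partial ord0 (partial ord0 (incoming a b)) x =
    incoming (partial ord0 (partial ord0 a))
      (fun i => partial ord0 (partial ord0 (b i))) x.
  rewrite -partial_time_incoming//; [|exact: dda|by move=> i; exact: ddb].
  apply: partial_off_axis; last by rewrite inE.
  move=> y; rewrite inE => Uy.
  by apply: partial_time_incoming => //; [exact: da|move=> i; exact: db].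
rewrite -(@box_incoming_algebra _ _ _ (spatial x) _ _ _ _
   (fun j i => partial (lift ord0 j) (partial (lift ord0 j) (b i)) x)) ;
  [|exact: off_axis_neq0|exact: sqr_shell_radius].
congr (_ + _); apply: eq_bigr => j _; set d := partial (lift ord0 j).
(* The second derivative acts on the remainder of the first and also creates a new one from
   [incoming]; hence the factors 2 in the result. *)
have -> : d (d (incoming a b)) x = d (incoming (d a) (fun i => d (b i)) +
    ((fun y => (shell_radius y)^-1 * spatial y j * a y) - b j)) x.
  apply: partial_off_axis; last by rewrite inE.
  move=> y; rewrite inE => Uy.
  by apply: partial_space_incoming => //; [exact: da|move=> i; exact: db].
have ha := is_derive_partial (lift ord0 j) (dda (lift ord0 j) x Ux).
have hb i := is_derive_partial (lift ord0 j) (ddb i (lift ord0 j) x Ux).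
have hI := is_derive_incoming Ux ha hb.
have hd : derivable (fun y => (shell_radius y)^-1 * spatial y j * a y) x
    (delta_mx 0 (lift ord0 j)).
  apply: derivableM; last exact/diff_derivable/da.
  apply: derivableM.
    by have [] := is_derive_inv_shell_radius (delta_mx 0 (lift ord0 j)) Ux.
  by have [] := is_derive_spatial x (delta_mx 0 (lift ord0 j)) j.
have hbj : derivable (b j) x (delta_mx 0 (lift ord0 j)).
  exact/diff_derivable/db.
rewrite {1}/d /partial.
rewrite (deriveD (ex_derive (is_derive := hI)) (derivableB hd hbj)).
rewrite (deriveB hd hbj) -/(partial (lift ord0 j) (incoming _ _) x).
rewrite -/(partial (lift ord0 j) (fun y => _ * a y) x).
rewrite partial_space_incoming//; [|exact: dda|by move=> i; exact: ddb].
by rewrite partial_space_direction//; exact: da.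
Qed.

End Incoming.

(** * The ugly equation with p = 1 under the incoming derivative *)

Section Ugly.
Variable R : realType.
Implicit Types (f g a : 'rV[R]_4 -> R) (x v : 'rV[R]_4) (i j : 'I_3) (k : 'I_4).

Lemma Ck_pred m f : Ck m.+1 (off_axis R) f -> Ck m (off_axis R) f.
Proof.
elim: m f => [|m IH] f [df Cf]; first by move=> x /df/differentiable_continuous.
by split=> // k; exact/IH/Cf.
Qed.

Lemma boxE f : box f = - partial ord0 (partial ord0 f) +
  \sum_(i < 3) partial (lift ord0 i) (partial (lift ord0 i) f).
Proof. by apply/funext => x; rewrite /box /= fct_sumE. Qed.

Lemma differentiable_box f x : Ck 3 (off_axis R) f -> off_axis R x ->
  differentiable (box f) x.
Proof.
move=> [_ Cf] Ux; have dd k : differentiable (partial k (partial k f)) x.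
  exact: (((Cf k).2 k).1).
rewrite boxE; apply: differentiableD; first exact: differentiableN.
by apply: differentiable_sum => i; exact: dd.
Qed.

Lemma partial_box f k x : Ck 3 (off_axis R) f -> off_axis R x ->
  partial k (box f) x = box (partial k f) x.
Proof.
move=> C3 Ux; have C2 := Ck_pred C3; have [_ Cf] := C3.
have Ux' : x \in off_axis R by rewrite inE.
have dd l : derivable (partial l (partial l f)) x (delta_mx 0 k).
  exact/diff_derivable/(((Cf l).2 l).1).
have comm l : partial k (partial l (partial l f)) x =
    partial l (partial l (partial k f)) x.
  (* The first swap is symmetry for [partial l f]; the second is symmetry for [f], differentiated
     along [l]. *)
  exact: (etrans (partial_comm k l (Cf l) Ux')
    (partial_off_axis l (partial_comm k l C2) Ux')).
have hs := is_derive_sum (fun i => derivableP (dd (lift ord0 i))).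
have h := is_deriveD (is_deriveN (derivableP (dd ord0))) hs.
rewrite boxE {1}/partial (derive_val (is_derive := h)).
rewrite /box -(comm ord0); apply: f_equal; apply: eq_bigr => i _; exact: comm.
Qed.

(** Along the incoming null vector R has derivative -1, so R^2 has derivative -2R. *)
Lemma dpsibar_sqr_shell_radius f x : off_axis R x -> differentiable f x ->
  dpsibar (fun y => shell_radius y ^+ 2 * f y) x =
  shell_radius x ^+ 2 * dpsibar f x - 2 * shell_radius x * f x.
Proof.
move=> Ux df; have r0 := off_axis_neq0 Ux.
have D v : 'D_v (fun y => shell_radius y ^+ 2 * f y) x =
    shell_radius x ^+ 2 * 'D_v f x +
    2 * (\sum_i spatial x i * spatial v i) * f x.
  have hf : is_derive x v f _ := derivableP (diff_derivable df).
  have hr := is_derive_shell_radius v Ux.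
  rewrite (derive_val (is_derive := is_deriveM (is_deriveM hr hr) hf)).
  rewrite /GRing.scale /=; move: (\sum_i _) => s.
  rewrite -[(_ * _) x]/(shell_radius x * shell_radius x).
  move: (shell_radius x) r0 ('D_v f x) (f x) => r r0 d c.
  by field.
rewrite /dpsibar /dT /dR /partial !D sum_spatial_time.
under eq_bigr do rewrite spatial_radial mulrA -expr2.
rewrite -mulr_suml -sqr_shell_radius.
move: (shell_radius x) r0 ('D_(delta_mx 0 ord0) f x) ('D_(radial x) f x) (f x).
move=> r r0 dt dr c.
by field.
Qed.

(* The F for which f solves the ugly equation with p = 1. *)
Definition reduced_source f y := box f y - 2 * ((shell_radius y)^-1 * dT f y).

Lemma partial_reduced_source f x k : Ck 3 (off_axis R) f -> off_axis R x ->
  partial k (reduced_source f) x = partial k (box f) x -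
    2 * ((shell_radius x)^-1 * partial k (dT f) x - (shell_radius x)^-3 *
      (\sum_i spatial x i * spatial (delta_mx 0 k) i) * dT f x).
Proof.
move=> C3 Ux; have [_ Cf] := C3.
have ha := is_derive_partial k ((Cf ord0).1 x Ux).
have hb := is_derive_partial k (differentiable_box C3 Ux).
have hr := is_derive_inv_shell_radius (delta_mx 0 k) Ux.
have hc := is_derive_cst (2 : R) x (delta_mx 0 k : 'rV[R]_4).
have h := is_deriveB hb (is_deriveM hc (is_deriveM hr ha)).
rewrite {1}/partial (derive_val (is_derive := h)).
rewrite scaler0 addr0 /GRing.scale /= /dT; congr (_ - _ * _).
by ring.
Qed.

(** The source F gets its differentiability from here: off the axis it agrees with this expression
    in the C^3 solution. *)
Lemma differentiable_reduced_source f x : Ck 3 (off_axis R) f -> off_axis R x ->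
  differentiable (reduced_source f) x.
Proof.
move=> C3 Ux; have [_ Cf] := C3; apply: differentiableB.
  exact: differentiable_box.
apply: differentiableM; first exact: differentiable_cst.
apply: differentiableM; last exact: (Cf ord0).1.
apply: differentiableV; first exact: differentiable_shell_radius.
exact: off_axis_neq0.
Qed.

(** Here [b0] and [b i] are the derivatives of box f, [a] is d_T f with derivatives [a0] and [a1 i],
    and [D i] is d_i d_i f. The Laplacian in -2 d_i b_i is box f + d_T^2 f, and its d_T^2 f cancels
    against R d_T of (2/R) d_T f. The factor [0] is the time derivative of R^2 / 2. *)
Lemma ugly_algebra (r a a0 b0 : R) (X b a1 D : 'I_3 -> R) :
  r != 0 -> r ^+ 2 = \sum_i X i ^+ 2 ->
  r * b0 - \sum_i X i * b i + 2 / r * (\sum_i X i * a1 i) + 2 / r * a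
    - 2 * (\sum_i D i) =
  (r * (b0 - 2 * (r^-1 * a0 - r^-3 * 0 * a))
    - \sum_i X i * (b i - 2 * (r^-1 * a1 i - r^-3 * X i * a)))
  - 2 * (- a0 + \sum_i D i - 2 * (r^-1 * a)).
Proof.
move=> r0 rX.
have -> : \sum_i X i * (b i - 2 * (r^-1 * a1 i - r^-3 * X i * a)) =
    \sum_i X i * b i - 2 / r * (\sum_i X i * a1 i) + 2 * r^-3 * a * r ^+ 2.
  by rewrite rX !big_ord_recl !big_ord0; ring.
move: (\sum_i _) (\sum_i _) (\sum_i _) => s1 s2 s3.
by field.
Qed.

Lemma box_incoming_ugly f x : Ck 3 (off_axis R) f -> off_axis R x ->
  box (fun y => shell_radius y * dpsibar f y) x =
  shell_radius x * dpsibar (reduced_source f) x - 2 * reduced_source f x.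
Proof.
move=> C3 Ux; have [df Cf] := C3; have r0 := off_axis_neq0 Ux.
have Ux' : x \in off_axis R by rewrite inE.
rewrite (incoming_dpsibar Ux (differentiable_reduced_source C3 Ux)).
rewrite (@box_off_axis _ _
  (incoming (partial ord0 f) (fun i => partial (lift ord0 i) f)))//; last first.
  by move=> y; rewrite inE => Uy; exact: (incoming_dpsibar Uy (df y Uy)).
have C2 k : Ck 2 (off_axis R) (partial k f) by exact: Cf.
rewrite (box_incoming Ux (C2 ord0) (fun i => C2 (lift ord0 i))).
rewrite /incoming -partial_box// partial_reduced_source// sum_spatial_time.
under eq_bigr do rewrite -partial_box//.
under [in RHS]eq_bigr do rewrite partial_reduced_source// sum_spatial_space.
exact: ugly_algebra (sqr_shell_radius x).
Qed.

End Ugly.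

(** * Orders of decay near null infinity *)

Section Decay.
Variable R : realType.
Implicit Types (f g : 'rV[R]_4 -> R) (x : 'rV[R]_4) (n : nat).

Lemma decaysP n f : decays n f <-> forall a b : R, exists2 c : R, 0 < c &
  \forall x \near null_infinity a b, `|f x| <= c * (shell_radius x) ^- n.
Proof.
have E x : `|(shell_radius x) ^- n| = (shell_radius x) ^- n.
  by rewrite ger0_norm// invr_ge0 exprn_ge0// shell_radius_ge0.
split=> [fn a b|fn a b].
  have /eqO_exP[c c0 fc] := fn a b; exists c => //.
  by apply: filterS fc => x; rewrite E.
apply/eqO_exP; have [c c0 fc] := fn a b; exists c => //.
by apply: filterS fc => x; rewrite E.
Qed.

Lemma null_infinity_radius_ge (a b m : R) :
  \forall x \near null_infinity a b, m <= shell_radius x.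
Proof.
suff H : null_infinity a b [set x | m <= shell_radius x] by exact: H.
apply: filterS (nbhs_pinfty_ge (num_real m)) => r mr x xr _.
by rewrite /= xr.
Qed.

Lemma null_infinity_off_axis (a b : R) :
  \forall x \near null_infinity a b, off_axis R x.
Proof.
apply: filterS (null_infinity_radius_ge a b 1) => x.
exact: lt_le_trans.
Qed.

(** Points near null infinity have radius at least 1, so only values off the axis matter. *)
Lemma decays_off_axis n f g : {in off_axis R, f =1 g} ->
  decays n f -> decays n g.
Proof.
move=> fg /decaysP fn; apply/decaysP => a b; have [c c0 fc] := fn a b.
exists c => //; apply: filterS2 fc (null_infinity_off_axis a b) => x fx Ux.
by rewrite -fg ?inE.
Qed.

Lemma decaysS n f : decays n.+1 f -> decays n f.
Proof.
move=> /decaysP fn; apply/decaysP => a b; have [c c0 fc] := fn a b.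
exists c => //; apply: filterS2 fc (null_infinity_radius_ge a b 1) => x fx r1.
have r0 := lt_le_trans ltr01 r1.
rewrite (le_trans fx)// ler_pM2l// lef_pV2 ?posrE ?exprn_gt0//.
exact: ler_weXn2l.
Qed.

Lemma decaysD n f g : decays n f -> decays n g -> decays n (fun x => f x + g x).
Proof.
move=> /decaysP fn /decaysP gn; apply/decaysP => a b.
have [c c0 fc] := fn a b; have [d d0 gd] := gn a b.
exists (c + d); first exact: addr_gt0.
apply: filterS2 fc gd => x fx gx.
by rewrite (le_trans (ler_normD _ _))// mulrDl lerD.
Qed.

Lemma decaysZ n (c : R) f : decays n f -> decays n (fun x => c * f x).
Proof.
move=> /decaysP fn; apply/decaysP => a b; have [d d0 fd] := fn a b.
(* The [1] keeps the constant positive when [c = 0]. *)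
exists ((`|c| + 1) * d); first by rewrite mulr_gt0// ltr_wpDl.
apply: filterS fd => x fx.
by rewrite normrM -mulrA ler_pM// lerDl.
Qed.

Lemma decays0 n : decays n (fun=> 0 : R).
Proof.
apply/decaysP => a b; exists 1 => //; apply: filterE => x.
by rewrite normr0 mul1r invr_ge0 exprn_ge0 ?shell_radius_ge0.
Qed.

(** Off the axis the two bounds are one inequality, up to division by R. One direction bounds the
    source, the other shows that a bad source is not O(R^-3). *)
Lemma decaysM_radius n f :
  decays n (fun x => shell_radius x * f x) <-> decays n.+1 f.
Proof.
have E c x : off_axis R x ->
    (`|shell_radius x * f x| <= c * (shell_radius x) ^- n) =
    (`|f x| <= c * (shell_radius x) ^- n.+1).
  move=> Ux; have r0 := off_axis_neq0 Ux.
  rewrite normrM (ger0_norm (shell_radius_ge0 x)) -ler_pdivlMl// exprS invfM.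
  by rewrite mulrCA.
split=> /decaysP fn; apply/decaysP => a b; have [c c0 fc] := fn a b.
  exists c => //.
  by apply: filterS2 fc (null_infinity_off_axis a b) => x fx /E<-.
exists c => //.
by apply: filterS2 fc (null_infinity_off_axis a b) => x fx /E->.
Qed.

End Decay.

(** An improved derivative of F is rendered as [decays 4 (dpsibar F)], a gain of one order; a
    derivative that merely keeps the decay of F, as [decays 3] without [decays 4]. *)
Theorem mainTheorem1 (R : realType) (phi F : 'rV[R]_4 -> R)
    (phi_C3 : Ck 3 (off_axis R) phi)
    (F_decays : decays 3 F)
    (phi_ugly : ugly_equation 1 phi F)
    (phi_oplus : oplus phi (fun=> 1)) :
  let Phi := fun x => shell_radius x * dpsibar phi x in
  let source := fun x =>
    (shell_radius x)^-1 * dpsibar (fun y => shell_radius y ^+ 2 * F y) x in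
  [/\ wave_equation Phi source,
      decays 3 (dpsibar F) /\ ~ decays 4 (dpsibar F) -> bad_equation Phi source
    & (forall x, off_axis R x -> F x = 0) \/ decays 4 (dpsibar F) ->
      good_equation Phi source].
Proof.
move=> Phi source.
(* The ugly equation is solved for F. *)
have F_eq : {in off_axis R, F =1 reduced_source phi}.
  move=> x; rewrite inE => Ux; rewrite /reduced_source (phi_ugly x Ux).
  by rewrite muln1 mulrA addrAC subrr add0r.
have source_eq x : off_axis R x ->
    source x = shell_radius x * dpsibar F x - 2 * F x.
  move=> Ux; have r0 := off_axis_neq0 Ux.
  have Ux' : x \in off_axis R by rewrite inE.
  have r2F : {in off_axis R, (fun y => shell_radius y ^+ 2 * F y) =1
      (fun y => shell_radius y ^+ 2 * reduced_source phi y)}.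
    by move=> y Uy; rewrite F_eq.
  rewrite /source (dpsibar_off_axis r2F Ux') (dpsibar_off_axis F_eq Ux').
  rewrite F_eq// dpsibar_sqr_shell_radius//; last first.
    exact: differentiable_reduced_source.
  move: (shell_radius x) r0 (dpsibar _ x) (reduced_source _ x) => r r0 d c.
  by field.
have wave : wave_equation Phi source.
  move=> x Ux; have Ux' : x \in off_axis R by rewrite inE.
  rewrite source_eq// (dpsibar_off_axis F_eq Ux') F_eq//.
  exact: box_incoming_ugly.
have source_decays n : decays n F -> decays n.+1 (dpsibar F) -> decays n source.
  move=> /(decaysZ (- 2)) Fn /decaysM_radius/decaysD/(_ Fn).
  by apply: decays_off_axis => x; rewrite inE => /source_eq->; rewrite mulNr.
split=> //.
- case=> DF3 nDF4; split=> //.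
    by apply: source_decays => //; exact: decaysS.
  (* Adding 2F = O(R^-3) back to the source isolates R psibar(F). *)
  move=> source3; apply: nDF4; apply/decaysM_radius.
  apply: (decays_off_axis _ (decaysD source3 (decaysZ 2 F_decays))) => x.
  by rewrite inE => /source_eq->; rewrite subrK.
- move=> H; split=> //; apply: source_decays => //; case: H => // F0.
  (* Off the axis F agrees with the constant 0, so psibar(F) vanishes there. *)
  apply: (decays_off_axis _ (@decays0 R 4)) => x Ux.
  rewrite (@dpsibar_off_axis _ F (cst 0)) ?Ux//.
    by rewrite /dpsibar /dT /dR /partial !derive_cst subrr.
  by move=> y; rewrite inE => /F0.
Qed.
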